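(* Let $B: H^\infty \to H^\infty$ be the backward shift operator $B(f)(z) = (f(z)-f(0))/z$. Then the operator norm of $B$ on $H^\infty$ is equal to $2$.
   Context: $\mathbb{D}$ is the open unit disc in $\mathbb{C}$. $H^\infty$ is the space of bounded analytic functions $f$ on $\mathbb{D}$ with norm $\|f\|_{H^\infty} = \sup_{z \in \mathbb{D}} |f(z)|$. The function $(f(z)-f(0))/z$ is extended analytically across $z=0$. *)

(* Defs.v *)
From Stdlib Require Import Reals Lra Lia.
From Coquelicot Require Import Coquelicot.
Open Scope R_scope.

(** * The space [Hinf] of bounded analytic functions on the unit disc *)

Definition disc (z : C) : Prop := Cmod z < 1.

(** Only the values of [f] on the disc matter: [r] may be taken smaller than
    the distance from [z0] to the unit circle. *)
Definition analytic_on_disc (f : C -> C) : Prop :=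
  forall z0 : C, disc z0 ->
  exists (a : nat -> C) (r : R), 0 < r /\
    forall z : C, Cmod (z - z0)%C < r ->
      @is_pseries C_AbsRing C_NormedModule a (z - z0)%C (f z).

Definition bounded_on_disc (f : C -> C) : Prop :=
  exists M : R, forall z : C, disc z -> Cmod (f z) <= M.

(** Functions are total on [C]; their values off the disc are irrelevant
    (in particular they do not enter [Hnorm]). *)
Record Hinf : Type := mkHinf {
  Hfun :> C -> C;
  Hfun_analytic : analytic_on_disc Hfun;
  Hfun_bounded : bounded_on_disc Hfun
}.

(** [real] forgets that the supremum lives in [Rbar]; on [Hinf] the supremum
    is finite. *)
Definition Hnorm (f : Hinf) : R :=
  real (Lub_Rbar (fun r : R => exists z : C, disc z /\ r = Cmod (f z))).

(** Valued in [Rbar], so that an unbounded operator has norm [p_infty]. *)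
Definition operator_norm (T : Hinf -> Hinf) : Rbar :=
  Lub_Rbar (fun r : R => exists f : Hinf, Hnorm f <= 1 /\ r = Hnorm (T f)).

(** * The backward shift *)

(** The analytic extension of [(f z - f 0) / z] takes the value [f'(0)] at
    [0]; [backward_shift_analytic] confirms that this choice is analytic. *)
Definition backward_shift_fun (f : C -> C) (z : C) : C :=
  if Ceq_dec z 0 then C_derive f 0 else ((f z - f 0%C) / z)%C.

Local Notation is_psC := (@is_pseries C_AbsRing C_NormedModule).

Lemma is_psC_unique (a : nat -> C) (z l1 l2 : C) :
  is_psC a z l1 -> is_psC a z l2 -> l1 = l2.
Proof.
intros H1 H2.
exact (@filterlim_locally_unique nat C_AbsRing C_NormedModule _ _ _ l1 l2 H1 H2).
Qed.

Lemma Cmod_pow_n (z : C) (n : nat) :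
  Cmod (@pow_n C_Ring z n) = (Cmod z) ^ n.
Proof.
induction n as [|n IH].
- exact Cmod_1.
- change (Cmod (z * @pow_n C_Ring z n)%C = Cmod z * Cmod z ^ n).
  now rewrite Cmod_mult, IH.
Qed.

Lemma psC_coef_bound (a : nat -> C) (z l : C) :
  is_psC a z l -> exists K, forall n, Cmod (a n) * Cmod z ^ n <= K.
Proof.
intros H.
assert (HC := @Cauchy_ex_series C_AbsRing C_CompleteNormedModule
  (fun k => @scal C_AbsRing C_NormedModule (@pow_n C_Ring z k) (a k))
  (ex_intro _ l H)).
destruct (HC (mkposreal 1 Rlt_0_1)) as [N HN]; simpl in HN.
assert (Hfin : forall m, exists K, forall n, (n < m)%nat ->
  Cmod (a n) * Cmod z ^ n <= K).
{ induction m as [|m [K HK]].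
  - exists 0; intros n Hn; lia.
  - exists (Rmax K (Cmod (a m) * Cmod z ^ m)); intros n Hn.
    destruct (Nat.eq_dec n m) as [->|Hnm].
    + apply Rmax_r.
    + apply Rle_trans with (2 := Rmax_l _ _). apply HK; lia. }
destruct (Hfin N) as [K HK].
exists (Rmax K 1); intros n.
destruct (Compare_dec.le_lt_dec N n) as [Hn|Hn].
- apply Rle_trans with (2 := Rmax_r _ _).
  specialize (HN n n Hn Hn). rewrite sum_n_n in HN.
  change (Cmod (@pow_n C_Ring z n * a n)%C < 1) in HN.
  rewrite Cmod_mult, Cmod_pow_n in HN. lra.
- apply Rle_trans with (2 := Rmax_l _ _). now apply HK.
Qed.

Lemma psC_term_bound (b : nat -> C) (rho K : R) (h : C) (n : nat) :
  0 < rho -> (forall n, Cmod (b n) * rho ^ n <= K) ->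
  Cmod (@pow_n C_Ring h n * b n)%C <= K * (Cmod h / rho) ^ n.
Proof.
intros Hr Hb.
rewrite Cmod_mult, Cmod_pow_n.
assert (Hrn : 0 < rho ^ n) by now apply pow_lt.
replace (Cmod h ^ n * Cmod (b n))
  with ((Cmod (b n) * rho ^ n) * (Cmod h / rho) ^ n).
- apply Rmult_le_compat_r; [|apply Hb].
  apply pow_le, Rdiv_le_0_compat; [apply Cmod_ge_0 | exact Hr].
- unfold Rdiv; rewrite Rpow_mult_distr, pow_inv. field. lra.
Qed.

Lemma psC_ex (b : nat -> C) (rho K : R) (h : C) :
  0 < rho -> (forall n, Cmod (b n) * rho ^ n <= K) ->
  Cmod h < rho -> exists l : C, is_psC b h l.
Proof.
intros Hr Hb Hh.
apply (@ex_series_le C_AbsRing C_CompleteNormedModule _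
  (fun n => K * (Cmod h / rho) ^ n)).
- intros n; exact (psC_term_bound b rho K h n Hr Hb).
- apply (@ex_series_scal_l R_AbsRing R_NormedModule K).
  apply ex_series_geom.
  assert (0 <= Cmod h / rho)
    by (apply Rdiv_le_0_compat; [apply Cmod_ge_0 | exact Hr]).
  rewrite Rabs_pos_eq by assumption.
  apply Rmult_lt_reg_r with rho; [exact Hr|].
  unfold Rdiv; rewrite Rmult_assoc, Rinv_l by lra. lra.
Qed.

Lemma psC_norm_le (b : nat -> C) (rho K : R) (h l : C) :
  0 < rho -> (forall n, Cmod (b n) * rho ^ n <= K) ->
  Cmod h <= rho / 2 -> is_psC b h l -> Cmod l <= 2 * K.
Proof.
intros Hr Hb Hh Hl.
assert (HK : 0 <= K).
{ apply Rle_trans with (2 := Hb 0%nat). simpl.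
  rewrite Rmult_1_r. apply Cmod_ge_0. }
assert (Hq : 0 <= Cmod h / rho <= / 2).
{ split; [apply Rdiv_le_0_compat; [apply Cmod_ge_0 | exact Hr]|].
  apply Rmult_le_reg_r with rho; [exact Hr|].
  unfold Rdiv; rewrite Rmult_assoc, Rinv_l by lra. lra. }
pose (u := fun k => @scal C_AbsRing C_NormedModule (@pow_n C_Ring h k) (b k)).
assert (Hn : forall n, Cmod (sum_n u n) <= 2 * K - K * (/ 2) ^ n).
{ induction n as [|n IH].
  - rewrite sum_O.
    apply Rle_trans with (1 := psC_term_bound b rho K h 0 Hr Hb). simpl; lra.
  - rewrite sum_Sn.
    apply Rle_trans with (1 := Cmod_triangle _ _).
    assert (H1 := psC_term_bound b rho K h (S n) Hr Hb).
    assert (H2 := pow_incr _ _ (S n) Hq).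
    assert (H3 := Rmult_le_compat_l _ _ _ HK H2).
    change (Cmod (@pow_n C_Ring h (S n) * b (S n))%C) with (Cmod (u (S n))) in H1.
    replace (K * (/ 2) ^ n) with (2 * (K * (/ 2) ^ S n)) in IH by (simpl; field).
    lra. }
apply (is_lim_seq_le (fun n => Cmod (sum_n u n)) (fun _ => 2 * K)
  (Cmod l) (2 * K)).
- intros n. apply Rle_trans with (1 := Hn n).
  assert (0 <= K * (/ 2) ^ n)
    by (apply Rmult_le_pos; [exact HK | apply pow_le; lra]).
  lra.
- apply (filterlim_comp _ _ _ (sum_n u) Cmod _ _ _ Hl
    (@filterlim_norm C_AbsRing C_NormedModule l)).
- apply is_lim_seq_const.
Qed.

Lemma coef_bound_shift (a : nat -> C) (rho K : R) :
  0 < rho -> (forall n, Cmod (a n) * rho ^ n <= K) ->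
  forall n, Cmod (PS_decr_1 a n) * rho ^ n <= K / rho.
Proof.
intros Hr Ha n; unfold PS_decr_1.
apply Rmult_le_reg_r with rho; [exact Hr|].
unfold Rdiv; rewrite (Rmult_assoc K), Rinv_l by lra.
specialize (Ha (S n)); simpl in Ha. lra.
Qed.

Lemma psC_0 (a : nat -> C) (l : C) : is_psC a (RtoC 0) l -> l = a 0%nat.
Proof.
intros H. apply (is_psC_unique a (RtoC 0) l (a 0%nat) H).
exact (@is_pseries_0 C_AbsRing C_NormedModule a).
Qed.

Lemma psC_decr (a : nat -> C) (z l : C) :
  z <> 0%C -> is_psC a z l -> is_psC (PS_decr_1 a) z ((l - a 0%nat) / z)%C.
Proof.
intros Hz H.
assert (Hd := @is_pseries_decr_1 C_AbsRing C_NormedModule a z (/ z)%C l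
  (Cinv_l z Hz) H).
replace ((l - a 0%nat) / z)%C with (/ z * (l - a 0%nat))%C
  by (unfold Cdiv; ring).
exact Hd.
Qed.

Lemma Cderive_0_pseries (f : C -> C) (a : nat -> C) (r : R) :
  0 < r -> (forall z : C, Cmod z < r -> is_psC a z (f z)) ->
  C_derive f 0 = a 1%nat.
Proof.
intros Hr Hf.
assert (Hf0 : f 0%C = a 0%nat) by (apply psC_0, Hf; rewrite Cmod_0; exact Hr).
assert (Hm : Cmod (RtoC (r / 2)) = r / 2)
  by (rewrite Cmod_R, Rabs_pos_eq; lra).
destruct (psC_coef_bound a (RtoC (r / 2)) (f (RtoC (r / 2)))) as [K HK].
{ apply Hf; rewrite Hm; lra. }
rewrite Hm in HK.
set (K2 := K / (r / 2) / (r / 2)).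
assert (HK2 : forall n, Cmod (PS_decr_1 (PS_decr_1 a) n) * (r / 2) ^ n <= K2).
{ apply coef_bound_shift; [lra|]. apply coef_bound_shift; [lra|exact HK]. }
assert (Hq : forall z : C, z <> 0%C -> Cmod z <= r / 2 / 2 ->
  Cmod ((f z - f 0%C) / (z - 0) - a 1%nat)%C <= Cmod z * (2 * K2)).
{ intros z Hz Hzr.
  replace (z - 0)%C with z by ring. rewrite Hf0.
  assert (H1 := psC_decr a z (f z) Hz ltac:(apply Hf; lra)).
  assert (H2 := psC_decr _ z _ Hz H1).
  assert (H3 : Cmod (((f z - a 0%nat) / z - a 1%nat) / z)%C <= 2 * K2)
    by exact (psC_norm_le _ (r / 2) K2 z _ ltac:(lra) HK2 Hzr H2).
  replace ((f z - a 0%nat) / z - a 1%nat)%C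
    with (z * (((f z - a 0%nat) / z - a 1%nat) / z))%C by (field; exact Hz).
  rewrite Cmod_mult. apply Rmult_le_compat_l; [apply Cmod_ge_0 | exact H3]. }
assert (Hl : forall (p : C -> R),
  (forall u v, p (u - v)%C = p u - p v) -> (forall u, Rabs (p u) <= Cmod u) ->
  real (Lim (fun x => p ((f (x, 0) - f 0%C) / ((x, 0) - 0))%C) 0) = p (a 1%nat)).
{ intros p Hp Hpn.
  assert (HL : is_lim (fun x => p ((f (x, 0) - f 0%C) / ((x, 0) - 0))%C) 0
    (p (a 1%nat))); [|now rewrite (is_lim_unique _ _ _ HL)].
  apply is_lim_spec. intros eps.
  assert (HM : 0 < Rmax 1 (2 * K2)) by (apply Rlt_le_trans with (2 := Rmax_l _ _); lra).
  assert (Hd : 0 < Rmin (r / 2 / 2) (eps / Rmax 1 (2 * K2))).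
  { apply Rmin_pos; [lra|]. apply Rdiv_lt_0_compat; [apply cond_pos | exact HM]. }
  exists (mkposreal _ Hd). intros x Hx Hx0.
  change (Rabs (x - 0) < Rmin (r / 2 / 2) (eps / Rmax 1 (2 * K2))) in Hx.
  rewrite Rminus_0_r in Hx.
  assert (Hx1 := Rlt_le_trans _ _ _ Hx (Rmin_l _ _)).
  assert (Hx2 := Rlt_le_trans _ _ _ Hx (Rmin_r _ _)).
  rewrite <- Hp. apply Rle_lt_trans with (1 := Hpn _).
  assert (Hc : Cmod (x, 0) = Rabs x) by exact (Cmod_R x).
  apply Rle_lt_trans with (Cmod (x, 0) * (2 * K2)).
  - apply Hq; [|rewrite Hc; lra]. intros E; apply Hx0; exact (f_equal fst E).
  - rewrite Hc. apply Rle_lt_trans with (Rabs x * Rmax 1 (2 * K2)).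
    + apply Rmult_le_compat_l; [apply Rabs_pos | apply Rmax_r].
    + apply Rmult_lt_compat_r with (1 := HM) in Hx2.
      unfold Rdiv in Hx2. rewrite Rmult_assoc, Rinv_l in Hx2 by lra. lra. }
assert (H1 := Hl fst ltac:(reflexivity)
  (fun u => Rle_trans _ _ _ (Rmax_l _ _) (Rmax_Cmod u))).
assert (H2 := Hl snd ltac:(reflexivity)
  (fun u => Rle_trans _ _ _ (Rmax_r _ _) (Rmax_Cmod u))).
rewrite (surjective_pairing (a 1%nat)), <- H1, <- H2. reflexivity.
Qed.

(** Near [0] the coefficient sequence is just shifted. *)
Lemma backward_shift_pseries_0 (f : C -> C) (a : nat -> C) (r : R) :
  0 < r -> (forall z : C, Cmod z < r -> is_psC a z (f z)) ->
  forall z : C, Cmod z < r -> is_psC (PS_decr_1 a) z (backward_shift_fun f z).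
Proof.
intros Hr Hf z Hz. unfold backward_shift_fun.
destruct (Ceq_dec z 0) as [->|Hz0].
- rewrite (Cderive_0_pseries f a r Hr Hf).
  exact (@is_pseries_0 C_AbsRing C_NormedModule (PS_decr_1 a)).
- assert (Hf0 : f 0%C = a 0%nat)
    by (apply psC_0, Hf; rewrite Cmod_0; exact Hr).
  rewrite Hf0. apply psC_decr; [exact Hz0 | now apply Hf].
Qed.

(** Coefficients of [(f z - c) / z] at [z0 <> 0], given those of [f]. *)
Fixpoint quotient_coef (z0 c : C) (a : nat -> C) (n : nat) : C :=
  match n with
  | O => ((a 0%nat - c) / z0)%C
  | S m => ((a (S m) - quotient_coef z0 c a m) / z0)%C
  end.

Lemma quotient_coef_bound (z0 c : C) (a : nat -> C) (rho K : R) :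
  0 < rho -> rho <= Cmod z0 / 2 -> (forall n, Cmod (a n) * rho ^ n <= K) ->
  forall n, Cmod (quotient_coef z0 c a n) * rho ^ n
            <= 2 * (K + Cmod c) / Cmod z0.
Proof.
intros Hr Hrz Ha.
assert (Hz : 0 < Cmod z0) by lra.
assert (Hz0 : z0 <> 0%C) by now apply Cmod_gt_0.
assert (HK : 0 <= K).
{ apply Rle_trans with (2 := Ha 0%nat). simpl.
  rewrite Rmult_1_r. apply Cmod_ge_0. }
assert (Hc := Cmod_ge_0 c).
assert (Hdiv : forall u, Cmod (u / z0)%C * Cmod z0 = Cmod u).
{ intros u. rewrite Cmod_div by exact Hz0. field; lra. }
induction n as [|n IH]; apply Rmult_le_reg_r with (1 := Hz);
  unfold Rdiv at 1; rewrite (Rmult_assoc (2 * _)), Rinv_l, Rmult_1_r by lra.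
- simpl quotient_coef. simpl pow. rewrite Rmult_1_r, Hdiv.
  specialize (Ha 0%nat); simpl in Ha.
  assert (H := Cmod_triangle (a 0%nat) (- c)%C). rewrite Cmod_opp in H.
  unfold Cminus. lra.
- simpl quotient_coef. set (q := quotient_coef z0 c a n) in *.
  rewrite Rmult_assoc, (Rmult_comm (rho ^ S n)), <- Rmult_assoc, Hdiv.
  assert (H := Cmod_triangle (a (S n)) (- q)%C). rewrite Cmod_opp in H.
  specialize (Ha (S n)).
  assert (Hp : 0 <= rho ^ S n) by (apply pow_le; lra).
  apply Rmult_le_compat_r with (1 := Hp) in H.
  assert (HI : Cmod q * rho ^ S n <= K + Cmod c).
  { replace (Cmod q * rho ^ S n) with (rho * (Cmod q * rho ^ n)) by (simpl; ring).
    apply Rle_trans with (rho * (2 * (K + Cmod c) / Cmod z0)).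
    - apply Rmult_le_compat_l; [lra | exact IH].
    - apply Rle_trans with (Cmod z0 / 2 * (2 * (K + Cmod c) / Cmod z0)).
      + apply Rmult_le_compat_r; [|exact Hrz].
        apply Rdiv_le_0_compat; [lra | exact Hz].
      + right; field; lra. }
  unfold Cminus. lra.
Qed.

Lemma quotient_coef_pseries (z0 c : C) (a : nat -> C) (h F S : C) :
  z0 <> 0%C -> is_psC a h F -> is_psC (quotient_coef z0 c a) h S ->
  ((z0 + h) * S = F - c)%C.
Proof.
intros Hz0 Ha HS.
set (b := quotient_coef z0 c a) in *.
assert (H1 : is_psC (fun n => z0 * b n)%C h (z0 * S)%C).
{ apply (@is_series_ext C_AbsRing C_NormedModule
    (fun k => @scal C_AbsRing C_NormedModule z0
       (@scal C_AbsRing C_NormedModule (@pow_n C_Ring h k) (b k)))).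
  - intros n.
    change (z0 * (@pow_n C_Ring h n * b n) = @pow_n C_Ring h n * (z0 * b n))%C.
    ring.
  - exact (@is_series_scal C_AbsRing C_NormedModule z0 _ S HS). }
assert (H2 := @is_pseries_incr_1 C_AbsRing C_NormedModule b h S HS).
assert (H3 := @is_pseries_plus C_AbsRing C_NormedModule _ _ h _ _ H1 H2).
assert (H4 : is_series (fun k : nat => @scal C_AbsRing C_NormedModule
    (@pow_n C_Ring h (Datatypes.S k)) (a (Datatypes.S k)))
    ((z0 + h) * S - (a 0%nat - c))%C).
{ apply (@is_series_ext C_AbsRing C_NormedModule (fun k =>
    @scal C_AbsRing C_NormedModule (@pow_n C_Ring h (Datatypes.S k))
    (@PS_plus C_AbsRing C_NormedModule (fun n => z0 * b n)%C
      (@PS_incr_1 C_AbsRing C_NormedModule b) (Datatypes.S k)))).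
  - intros n. f_equal.
    assert (E : forall u v : C, (z0 * ((u - v) / z0) + v)%C = u)
      by (intros; field; exact Hz0).
    exact (E (a (Datatypes.S n)) (b n)).
  - apply (@is_series_incr_1 C_AbsRing C_NormedModule (fun k =>
      @scal C_AbsRing C_NormedModule (@pow_n C_Ring h k)
      (@PS_plus C_AbsRing C_NormedModule (fun n => z0 * b n)%C
        (@PS_incr_1 C_AbsRing C_NormedModule b) k))).
    replace (plus _ _) with (z0 * S + h * S)%C; [exact H3|].
    assert (E : forall u : C, (z0 * S + h * S = (z0 + h) * S - (u - c)
      + 1 * (z0 * ((u - c) / z0) + 0))%C) by (intros; field; exact Hz0).
    exact (E (a 0%nat)). }
assert (H5 : is_series (fun k : nat => @scal C_AbsRing C_NormedModule
    (@pow_n C_Ring h (Datatypes.S k)) (a (Datatypes.S k))) (F - a 0%nat)%C).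
{ apply (@is_series_incr_1 C_AbsRing C_NormedModule (fun k =>
    @scal C_AbsRing C_NormedModule (@pow_n C_Ring h k) (a k))).
  replace (plus _ _) with F; [exact Ha|].
  assert (E : forall u : C, (F = F - u + 1 * u)%C) by (intros; ring).
  exact (E (a 0%nat)). }
assert (E := @filterlim_locally_unique nat C_AbsRing C_NormedModule
  eventually _ _ _ _ H4 H5).
simpl in E.
replace ((z0 + h) * S)%C
  with ((z0 + h) * S - (a 0%nat - c) + (a 0%nat - c))%C by ring.
rewrite E. ring.
Qed.

Lemma backward_shift_analytic (f : C -> C) :
  analytic_on_disc f -> analytic_on_disc (backward_shift_fun f).
Proof.
intros Hf z0 Hz0.
destruct (Hf z0 Hz0) as [a [r [Hr Ha]]].
destruct (Ceq_dec z0 0) as [->|Hn0].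
- exists (PS_decr_1 a), r. split; [exact Hr|].
  assert (Ha' : forall z : C, Cmod z < r -> is_psC a z (f z)).
  { intros z Hz. specialize (Ha z). replace (z - 0)%C with z in Ha by ring.
    now apply Ha. }
  intros z. replace (z - 0)%C with z by ring.
  now apply backward_shift_pseries_0.
- assert (Hz : 0 < Cmod z0) by now apply Cmod_gt_0.
  set (rho := Rmin (r / 2) (Cmod z0 / 2)).
  assert (Hrho : 0 < rho) by (apply Rmin_pos; lra).
  assert (Hr1 : rho <= r / 2) by apply Rmin_l.
  assert (Hr2 : rho <= Cmod z0 / 2) by apply Rmin_r.
  assert (Hm : Cmod (RtoC rho) = rho)
    by (rewrite Cmod_R, Rabs_pos_eq; lra).
  assert (Hsub : forall w : C, (z0 + w - z0 = w)%C) by (intros; ring).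
  destruct (psC_coef_bound a (RtoC rho) (f (z0 + RtoC rho)%C)) as [K HK].
  { rewrite <- (Hsub (RtoC rho)) at 1. apply Ha. rewrite Hsub, Hm. lra. }
  rewrite Hm in HK.
  assert (Hb := quotient_coef_bound z0 (f 0%C) a rho K Hrho Hr2 HK).
  exists (quotient_coef z0 (f 0%C) a), rho. split; [exact Hrho|].
  intros z Hzr.
  destruct (psC_ex _ rho _ (z - z0)%C Hrho Hb Hzr) as [S HS].
  assert (E := quotient_coef_pseries z0 (f 0%C) a (z - z0)%C (f z) S Hn0
    (Ha z ltac:(lra)) HS).
  replace (z0 + (z - z0))%C with z in E by ring.
  assert (Hzn : z <> 0%C).
  { intros ->. replace (0 - z0)%C with (- z0)%C in Hzr by ring.
    rewrite Cmod_opp in Hzr. lra. }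
  unfold backward_shift_fun. destruct (Ceq_dec z 0) as [|_]; [contradiction|].
  rewrite <- E. replace (z * S / z)%C with S by (field; exact Hzn).
  exact HS.
Qed.

Lemma backward_shift_bounded (f : C -> C) :
  analytic_on_disc f -> bounded_on_disc f ->
  bounded_on_disc (backward_shift_fun f).
Proof.
intros Hf [M HM].
assert (D0 : disc 0%C) by (unfold disc; rewrite Cmod_0; lra).
destruct (Hf 0%C D0) as [a [r [Hr Ha]]].
assert (Ha' : forall z : C, Cmod z < r -> is_psC a z (f z)).
{ intros z Hz. specialize (Ha z). replace (z - 0)%C with z in Ha by ring.
  now apply Ha. }
assert (Hm : Cmod (RtoC (r / 2)) = r / 2)
  by (rewrite Cmod_R, Rabs_pos_eq; lra).
destruct (psC_coef_bound a (RtoC (r / 2)) (f (RtoC (r / 2)))) as [K HK].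
{ apply Ha'; rewrite Hm; lra. }
rewrite Hm in HK.
assert (HK1 := coef_bound_shift a (r / 2) K ltac:(lra) HK).
exists (Rmax (2 * (K / (r / 2))) (2 * M / (r / 4))).
intros z Hz.
destruct (Rle_lt_dec (Cmod z) (r / 4)) as [Hs|Hb].
- apply Rle_trans with (2 := Rmax_l _ _).
  apply (psC_norm_le (PS_decr_1 a) (r / 2) _ z); [lra | exact HK1 | lra |].
  apply (backward_shift_pseries_0 f a r Hr Ha'). lra.
- apply Rle_trans with (2 := Rmax_r _ _).
  assert (Hz0 : z <> 0%C) by (apply Cmod_gt_0; lra).
  unfold backward_shift_fun. destruct (Ceq_dec z 0) as [|_]; [contradiction|].
  rewrite Cmod_div by exact Hz0.
  assert (H := Cmod_triangle (f z) (- f 0%C)%C). rewrite Cmod_opp in H.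
  fold (f z - f 0%C)%C in H.
  assert (H1 := HM z Hz). assert (H2 := HM 0%C D0).
  assert (H0 := Cmod_ge_0 (f z - f 0%C)%C).
  apply Rmult_le_compat; [exact H0 | | lra |].
  + left. apply Rinv_0_lt_compat. lra.
  + apply Rinv_le_contravar; lra.
Qed.

Definition backward_shift (f : Hinf) : Hinf :=
  mkHinf (backward_shift_fun f)
    (backward_shift_analytic f (Hfun_analytic f))
    (backward_shift_bounded f (Hfun_analytic f) (Hfun_bounded f)).

(* Main.v *)
(** Upper bound: on the circle [|z| = r] one has [|B f| <= 2 / r], which the
    maximum modulus principle extends to the disc of radius [r]; let [r] tend
    to [1]. Lower bound: for [f z = (z - a) / (1 - a z)] with [0 < a < 1] one
    finds [B f z = (1 - a^2) / (1 - a z)], which tends to [1 + a] as [z] tends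
    to [1]; let [a] tend to [1].

    For the maximum modulus principle, maximise
    [Re (l * f z) + eps * |z|^2] over a closed disc. At an interior maximum
    [z0] the values at the four points [z0 + t u], [u^4 = 1], average to the
    value at [z0] plus [eps * t^2 + O(t^3)], a contradiction. *)
From Stdlib Require Import Reals Lra ClassicalEpsilon.
From Coquelicot Require Import Coquelicot.
Require Import Defs.
Open Scope R_scope.

(** * Modulus against real and imaginary parts *)

Lemma Cmod_le_abs (z : C) : Cmod z <= Rabs (Re z) + Rabs (Im z).
Proof.
destruct z as [x y]; simpl.
rewrite <- (Rabs_pos_eq (Rabs x + Rabs y))
  by (apply Rplus_le_le_0_compat; apply Rabs_pos).
rewrite <- sqrt_Rsqr_abs. unfold Cmod; simpl. apply sqrt_le_1_alt.
unfold Rsqr.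
assert (Hx := Rsqr_abs x); assert (Hy := Rsqr_abs y); unfold Rsqr in *.
assert (0 <= Rabs x * Rabs y) by (apply Rmult_le_pos; apply Rabs_pos).
lra.
Qed.

Lemma Re_le_Cmod (z : C) : Rabs (Re z) <= Cmod z.
Proof. exact (Rle_trans _ _ _ (Rmax_l _ _) (Rmax_Cmod z)). Qed.

Lemma Im_le_Cmod (z : C) : Rabs (Im z) <= Cmod z.
Proof. exact (Rle_trans _ _ _ (Rmax_r _ _) (Rmax_Cmod z)). Qed.

Lemma Cmod_sqr (z : C) : Cmod z * Cmod z = Re z * Re z + Im z * Im z.
Proof.
unfold Cmod. rewrite sqrt_sqrt; [unfold Re, Im; ring|].
apply Rplus_le_le_0_compat; apply pow2_ge_0.
Qed.

(** * Extreme values on a closed disc *)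

(** Compactness, with one [d] serving both as neighbourhood radius and as parameter of [Q]. Since
    smaller [d] weakens [Q d], the least of finitely many local values works everywhere. *)
Lemma closed_disc_uniform (Q : R -> C -> Prop) (r : R) :
  (forall d d' w, 0 < d <= d' -> Q d' w -> Q d w) ->
  (forall p, Cmod p <= r -> exists d, 0 < d /\
     forall w, Cmod w <= r -> Cmod (w - p)%C < d -> Q d w) ->
  exists d, 0 < d /\ forall w, Cmod w <= r -> Q d w.
Proof.
intros Hmon Hloc.
assert (Hall : forall x y : R, exists d : posreal,
  forall w : C, Cmod w <= r -> Rabs (Re w - x) < d -> Rabs (Im w - y) < d ->
  Q d w).
{ intros x y.
  assert (Hd : forall (d : R) (w : C), Rabs (Re w - x) < d / 2 ->
    Rabs (Im w - y) < d / 2 -> Cmod (w - (x, y))%C < d).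
  { intros d w Hx Hy. apply Rle_lt_trans with (1 := Cmod_le_abs _).
    destruct w as [u v]; simpl in *. unfold Rminus in *. lra. }
  destruct (Rle_lt_dec (Cmod (x, y)) r) as [Hp|Hp].
  - destruct (Hloc _ Hp) as [d [Hd0 HQ]].
    assert (Hd2 : 0 < d / 2) by lra.
    exists (mkposreal _ Hd2); simpl. intros w Hw Hx Hy.
    apply Hmon with d; [lra|]. apply HQ; [exact Hw | now apply Hd].
  (* The gauge must be defined on the whole square. Around a centre outside the closed disc, the
     radius is so small that its cell misses the disc. *)
  - assert (Hd2 : 0 < (Cmod (x, y) - r) / 2) by lra.
    exists (mkposreal _ Hd2); simpl. intros w Hw Hx Hy. exfalso.
    assert (H := Hd _ w Hx Hy).
    assert (H' := Cmod_triangle w (- (w - (x, y)))%C).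
    rewrite Cmod_opp in H'.
    set (p := (x, y) : C) in *.
    replace (w + - (w - p))%C with p in H' by ring.
    lra. }
pose (delta x y := proj1_sig (constructive_indefinite_description _ (Hall x y))).
assert (Hdelta : forall x y w, Cmod w <= r -> Rabs (Re w - x) < delta x y ->
  Rabs (Im w - y) < delta x y -> Q (delta x y) w).
{ intros x y. exact (proj2_sig (constructive_indefinite_description _ (Hall x y))). }
destruct (compactness_value_2d (- r) r (- r) r delta) as [d Hd].
exists d. split; [apply cond_pos|]. intros w Hw.
assert (Hx := Rle_trans _ _ _ (Re_le_Cmod w) Hw).
assert (Hy := Rle_trans _ _ _ (Im_le_Cmod w) Hw).
apply Rabs_le_between in Hx. apply Rabs_le_between in Hy.
(* [compactness_value_2d] yields its cell only under a double negation. *)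
apply NNPP. intros HN. apply (Hd (Re w) (Im w) Hx Hy).
intros [i [j [_ [_ [Hi [Hj Hij]]]]]]. apply HN.
apply Hmon with (delta i j); [split; [apply cond_pos | exact Hij]|].
now apply Hdelta.
Qed.

(** Compactness is used twice: for an upper bound, written [/ d] so that it weakens as [d] shrinks,
    and then for a gap. If the supremum [M] were not attained, the local gaps below [M] would give a
    uniform one, hence a smaller upper bound. *)
Lemma closed_disc_max (v : C -> R) (r : R) :
  0 <= r ->
  (forall p, Cmod p <= r -> forall e, 0 < e -> exists d, 0 < d /\
     forall w, Cmod (w - p)%C < d -> Rabs (v w - v p) < e) ->
  exists p, Cmod p <= r /\ forall w, Cmod w <= r -> v w <= v p.
Proof.
intros Hr Hc.
destruct (closed_disc_uniform (fun d w => v w <= / d) r) as [d [Hd Hb]].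
{ intros d d' w Hdd Hw. apply Rle_trans with (1 := Hw).
  apply Rinv_le_contravar; lra. }
{ intros p Hp. destruct (Hc p Hp 1 Rlt_0_1) as [d [Hd H]].
  assert (HA := Rabs_pos (v p)).
  assert (Hi : 0 < / (Rabs (v p) + 1)) by (apply Rinv_0_lt_compat; lra).
  exists (Rmin d (/ (Rabs (v p) + 1))). split; [now apply Rmin_pos|].
  intros w _ Hwd.
  apply Rle_trans with (/ / (Rabs (v p) + 1)).
  - rewrite Rinv_inv.
    assert (H1 := H w (Rlt_le_trans _ _ _ Hwd (Rmin_l _ _))).
    apply Rabs_def2 in H1. assert (H2 := Rle_abs (v p)). lra.
  - apply Rinv_le_contravar; [now apply Rmin_pos | apply Rmin_r]. }
destruct (completeness (fun x => exists w, Cmod w <= r /\ x = v w))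
  as [M [HM HMl]].
{ exists (/ d). intros x [w [Hw ->]]. now apply Hb. }
{ exists (v 0%C), 0%C. rewrite Cmod_0. now split. }
assert (HM' : forall w, Cmod w <= r -> v w <= M)
  by (intros w Hw; apply HM; now exists w).
apply NNPP. intros HN.
assert (Hlt : forall p, Cmod p <= r -> v p < M).
{ intros p Hp. destruct (Rle_lt_dec M (v p)) as [H|H]; [|exact H].
  exfalso. apply HN. exists p. split; [exact Hp|].
  intros w Hw. apply Rle_trans with (2 := H). now apply HM'. }
destruct (closed_disc_uniform (fun d w => v w <= M - d) r) as [e [He Hbe]].
{ intros e e' w He Hw. lra. }
{ intros p Hp. assert (H := Hlt p Hp).
  destruct (Hc p Hp ((M - v p) / 2) ltac:(lra)) as [e [He H1]].
  exists (Rmin e ((M - v p) / 2)). split; [apply Rmin_pos; lra|].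
  intros w _ Hw.
  assert (H2 := H1 w (Rlt_le_trans _ _ _ Hw (Rmin_l _ _))).
  apply Rabs_def2 in H2. assert (H3 := Rmin_r e ((M - v p) / 2)). lra. }
assert (M <= M - e) by (apply HMl; intros x [w [Hw ->]]; now apply Hbe).
lra.
Qed.

(** * The maximum modulus principle *)

(** The remainder is [h ^ 3] times the series whose coefficients are shifted three times, and that
    series is bounded near 0. *)
Lemma analytic_taylor2 (f : C -> C) (z0 : C) :
  analytic_on_disc f -> disc z0 ->
  exists (a1 a2 : C) (rho K : R), 0 < rho /\ 0 <= K /\
    forall h, Cmod h <= rho ->
      Cmod (f (z0 + h)%C - f z0 - a1 * h - a2 * (h * h))%C <= K * Cmod h ^ 3.
Proof.
intros Hf Hz0. destruct (Hf z0 Hz0) as [a [r [Hr Ha]]].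
assert (Ha' : forall h, Cmod h < r ->
  @is_pseries C_AbsRing C_NormedModule a h (f (z0 + h)%C)).
{ intros h Hh. specialize (Ha (z0 + h)%C).
  replace (z0 + h - z0)%C with h in Ha by ring. now apply Ha. }
assert (Hf0 : f z0 = a 0%nat).
{ apply psC_0. replace (f z0) with (f (z0 + 0)%C) by (f_equal; ring).
  apply Ha'. rewrite Cmod_0. exact Hr. }
assert (Hm : Cmod (RtoC (r / 2)) = r / 2)
  by (rewrite Cmod_R, Rabs_pos_eq; lra).
destruct (psC_coef_bound a (RtoC (r / 2)) (f (z0 + RtoC (r / 2))%C)) as [K HK].
{ apply Ha'; rewrite Hm; lra. }
rewrite Hm in HK.
assert (HK1 := coef_bound_shift _ (r / 2) _ ltac:(lra) HK).
assert (HK2 := coef_bound_shift _ (r / 2) _ ltac:(lra) HK1).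
assert (HK3 := coef_bound_shift _ (r / 2) _ ltac:(lra) HK2).
set (K3 := K / (r / 2) / (r / 2) / (r / 2)) in *.
assert (HK0 : 0 <= K3).
{ apply Rle_trans with (2 := HK3 0%nat). simpl.
  rewrite Rmult_1_r. apply Cmod_ge_0. }
(* The coefficients are controlled at radius [r / 2]; [psC_norm_le] bounds the sum on half of that
   radius, by twice the constant. *)
exists (a 1%nat), (a 2%nat), (r / 4), (2 * K3).
split; [lra|]. split; [lra|]. intros h Hh.
destruct (Ceq_dec h 0) as [->|Hh0].
- replace (z0 + 0)%C with z0 by ring.
  assert (E : forall u v w : C, (u - u - v * 0 - w * (0 * 0) = 0)%C)
    by (intros; ring).
  rewrite E.
  rewrite Cmod_0. simpl. lra.
- assert (H1 := psC_decr _ h _ Hh0 (Ha' h ltac:(lra))).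
  assert (H2 := psC_decr _ h _ Hh0 H1).
  assert (H3 := psC_decr _ h _ Hh0 H2).
  assert (H4 := psC_norm_le _ (r / 2) K3 h _ ltac:(lra) HK3 ltac:(lra) H3).
  unfold PS_decr_1 in H4. rewrite <- Hf0 in H4.
  set (E := (_ / h)%C) in H4.
  replace (f (z0 + h)%C - f z0 - a 1%nat * h - a 2%nat * (h * h))%C
    with (h * (h * h) * E)%C by (unfold E; field; exact Hh0).
  rewrite !Cmod_mult.
  replace (2 * K3 * Cmod h ^ 3) with
    (Cmod h * (Cmod h * Cmod h) * (2 * K3)) by ring.
  apply Rmult_le_compat_l; [|exact H4].
  assert (H := Cmod_ge_0 h). repeat apply Rmult_le_pos; exact H.
Qed.

(** For [|h| < 1] the quadratic and cubic terms of the Taylor estimate are absorbed by [|h|]. *)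
Lemma analytic_lipschitz_at (f : C -> C) (z0 : C) :
  analytic_on_disc f -> disc z0 ->
  exists rho L : R, 0 < rho /\ 0 <= L /\
    forall w, Cmod (w - z0)%C < rho -> Cmod (f w - f z0)%C <= L * Cmod (w - z0)%C.
Proof.
intros Hf Hz0.
destruct (analytic_taylor2 f z0 Hf Hz0) as [a1 [a2 [rho [K [Hr [HK H]]]]]].
assert (H1 := Cmod_ge_0 a1). assert (H2 := Cmod_ge_0 a2).
exists (Rmin rho 1), (K + Cmod a1 + Cmod a2).
split; [apply Rmin_pos; lra|]. split; [lra|]. intros w Hw.
assert (Hw1 := Rlt_le_trans _ _ _ Hw (Rmin_l _ _)).
assert (Hw2 := Rlt_le_trans _ _ _ Hw (Rmin_r _ _)).
specialize (H (w - z0)%C ltac:(lra)).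
replace (z0 + (w - z0))%C with w in H by ring.
set (h := (w - z0)%C) in *.
assert (Hh := Cmod_ge_0 h).
replace (f w - f z0)%C with
  ((f w - f z0 - a1 * h - a2 * (h * h)) + (a1 * h + a2 * (h * h)))%C by ring.
apply Rle_trans with (1 := Cmod_triangle _ _).
assert (H3 := Cmod_triangle (a1 * h)%C (a2 * (h * h))%C).
rewrite !Cmod_mult in H3.
assert (Hsq : Cmod h * Cmod h <= Cmod h) by nra.
assert (Hcu : Cmod h ^ 3 <= Cmod h) by (simpl; nra).
assert (K * Cmod h ^ 3 <= K * Cmod h) by (apply Rmult_le_compat_l; lra).
assert (Cmod a2 * (Cmod h * Cmod h) <= Cmod a2 * Cmod h)
  by (apply Rmult_le_compat_l; lra).
lra.
Qed.

Lemma continuous_penalised (f : C -> C) (l p : C) (eps : R) :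
  analytic_on_disc f -> disc p -> 0 < eps ->
  forall e, 0 < e -> exists d, 0 < d /\ forall w, Cmod (w - p)%C < d ->
    Rabs (Re (l * f w)%C + eps * (Cmod w * Cmod w)
          - (Re (l * f p)%C + eps * (Cmod p * Cmod p))) < e.
Proof.
intros Hf Hp Heps e He.
destruct (analytic_lipschitz_at f p Hf Hp) as [rho [L [Hr [HL H]]]].
assert (Hl := Cmod_ge_0 l). assert (Hp0 := Cmod_ge_0 p). unfold disc in Hp.
(* The 3 bounds [|w| + |p|], as [|p| < 1] and [|w - p| < 1]; it enters by factoring
   [|w|^2 - |p|^2]. *)
set (A := Cmod l * L + 3 * eps).
assert (HlL : 0 <= Cmod l * L) by now apply Rmult_le_pos.
assert (HA : 0 < A) by (unfold A; lra).
assert (HeA : 0 < e / A) by now apply Rdiv_lt_0_compat.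
exists (Rmin rho (Rmin 1 (e / A))).
split; [apply Rmin_pos; [exact Hr | apply Rmin_pos; lra]|].
intros w Hw.
assert (Hw1 := Rlt_le_trans _ _ _ Hw (Rmin_l _ _)).
assert (Hw' := Rlt_le_trans _ _ _ Hw (Rmin_r _ _)).
assert (Hw2 := Rlt_le_trans _ _ _ Hw' (Rmin_l _ _)).
assert (Hw3 := Rlt_le_trans _ _ _ Hw' (Rmin_r _ _)).
clear Hw Hw'.
set (h := (w - p)%C) in *.
assert (Hh := Cmod_ge_0 h).
replace (_ - _) with (Re (l * (f w - f p))%C
  + eps * ((Cmod w - Cmod p) * (Cmod w + Cmod p)))
  by (unfold Re, Cmult, Cminus, Copp, Cplus; simpl; ring).
apply Rle_lt_trans with (1 := Rabs_triang _ _).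
assert (H1 : Rabs (Re (l * (f w - f p))%C) <= Cmod l * L * Cmod h).
{ apply Rle_trans with (1 := Re_le_Cmod _). rewrite Cmod_mult, Rmult_assoc.
  apply Rmult_le_compat_l; [exact Hl | now apply H]. }
assert (H2 : Rabs (Cmod w - Cmod p) <= Cmod h).
{ assert (T1 := Cmod_triangle p h). assert (T2 := Cmod_triangle w (- h)%C).
  rewrite Cmod_opp in T2.
  replace (p + h)%C with w in T1 by (unfold h; ring).
  replace (w + - h)%C with p in T2 by (unfold h; ring).
  apply Rabs_le. lra. }
assert (H3 : Cmod w + Cmod p <= 3) by (apply Rabs_le_between in H2; lra).
assert (Hw0 := Cmod_ge_0 w).
assert (H4 : Rabs (eps * ((Cmod w - Cmod p) * (Cmod w + Cmod p)))
  <= eps * (Cmod h * 3)).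
{ rewrite Rabs_mult, (Rabs_pos_eq eps) by lra.
  apply Rmult_le_compat_l; [lra|].
  rewrite Rabs_mult, (Rabs_pos_eq (_ + _)) by lra.
  apply Rmult_le_compat; [apply Rabs_pos | lra | exact H2 | exact H3]. }
apply Rle_lt_trans with (A * Cmod h); [unfold A; lra|].
apply Rlt_le_trans with (A * (e / A)); [now apply Rmult_lt_compat_l|].
right. field. lra.
Qed.

Lemma Cmod_sqr_add (z h : C) :
  Cmod (z + h)%C * Cmod (z + h)%C
  = Cmod z * Cmod z + 2 * (Re z * Re h + Im z * Im h) + Cmod h * Cmod h.
Proof.
rewrite !Cmod_sqr. destruct z, h. unfold Re, Im, Cplus; simpl. ring.
Qed.

Lemma penalised_no_interior_max (f : C -> C) (l z0 : C) (eps r : R) :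
  analytic_on_disc f -> 0 < eps -> r < 1 -> Cmod z0 < r ->
  ~ (forall w, Cmod w <= r -> Re (l * f w)%C + eps * (Cmod w * Cmod w)
                       <= Re (l * f z0)%C + eps * (Cmod z0 * Cmod z0)).
Proof.
intros Hf Heps Hr1 Hz Hmax.
destruct (analytic_taylor2 f z0 Hf) as [a1 [a2 [rho [K [Hr [HK H]]]]]];
  [unfold disc; lra|].
assert (Hl := Cmod_ge_0 l).
assert (HlK : 0 <= Cmod l * K) by now apply Rmult_le_pos.
(* The summand 1 keeps [A] positive and makes [A * t <= eps] force [Cmod l * K * t < eps], so that
   the cubic error cannot absorb the penalty. *)
set (A := Cmod l * K + 1).
assert (HeA : 0 < eps / A) by (apply Rdiv_lt_0_compat; unfold A; lra).
set (t := Rmin rho (Rmin (r - Cmod z0) (eps / A))).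
assert (Ht : 0 < t)
  by (apply Rmin_pos; [exact Hr | apply Rmin_pos; lra]).
assert (Ht1 : t <= rho) by apply Rmin_l.
assert (Ht2 : t <= r - Cmod z0)
  by (apply Rle_trans with (1 := Rmin_r _ _); apply Rmin_l).
assert (Ht3 : t <= eps / A)
  by (apply Rle_trans with (1 := Rmin_r _ _); apply Rmin_r).
(* Maximality at [z0 + h], with the Taylor remainder replaced by its worst case. *)
assert (Hlow : forall h, Cmod h = t ->
  Re (l * (a1 * h + a2 * (h * h)))%C - Cmod l * K * t ^ 3
    + eps * (2 * (Re z0 * Re h + Im z0 * Im h) + t * t) <= 0).
{ intros h Hh.
  assert (H1 := H h ltac:(lra)).
  assert (H2 := Hmax (z0 + h)%C
    ltac:(apply Rle_trans with (1 := Cmod_triangle _ _); lra)).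
  rewrite Cmod_sqr_add, Hh in H2. rewrite Hh in H1.
  set (E := (f (z0 + h)%C - f z0 - a1 * h - a2 * (h * h))%C) in H1.
  assert (H3 : Rabs (Re (l * E)%C) <= Cmod l * K * t ^ 3).
  { apply Rle_trans with (1 := Re_le_Cmod _). rewrite Cmod_mult, Rmult_assoc.
    now apply Rmult_le_compat_l. }
  apply Rabs_le_between in H3.
  replace (f (z0 + h)%C) with (f z0 + (a1 * h + a2 * (h * h)) + E)%C in H2
    by (unfold E; ring).
  assert (D : forall u v w : C,
    Re (l * (u + v + w))%C = Re (l * u)%C + Re (l * v)%C + Re (l * w)%C)
    by (intros; unfold Re, Cmult, Cplus; simpl; ring).
  rewrite D in H2. lra. }
assert (Hm : forall x y : R, x * x + y * y = t * t -> Cmod (x, y) = t).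
{ intros x y Hxy. unfold Cmod; simpl. rewrite !Rmult_1_r, Hxy.
  apply sqrt_square. lra. }
(* Over these four points both [h] and [h^2] sum to zero, as does the part of [|z0 + h|^2] linear in
   [h]. Only [eps * t^2] and the cubic error survive. *)
assert (P1 := Hlow (t, 0) (Hm t 0 ltac:(ring))).
assert (P2 := Hlow (0, t) (Hm 0 t ltac:(ring))).
assert (P3 := Hlow (- t, 0) (Hm (- t) 0 ltac:(ring))).
assert (P4 := Hlow (0, - t) (Hm 0 (- t) ltac:(ring))).
assert (S : eps * (t * t) <= Cmod l * K * t ^ 3).
{ clear -P1 P2 P3 P4. destruct l as [l1 l2], a1 as [b1 b2], a2 as [c1 c2].
  set (B := Cmod (l1, l2) * K * t ^ 3) in *. clearbody B.
  unfold Re, Im, Cmult, Cplus in *; simpl in *. lra. }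
assert (S1 : eps <= Cmod l * K * t).
{ apply Rmult_le_reg_r with (t * t); [now apply Rmult_lt_0_compat|].
  simpl in S. lra. }
assert (S2 : A * t <= eps).
{ apply Rle_trans with (A * (eps / A)).
  - apply Rmult_le_compat_l; [unfold A; lra | exact Ht3].
  - right. field. unfold A; lra. }
unfold A in S2. lra.
Qed.

(** With [l] the conjugate of [f z], [Re (l * f z)] is [|f z|^2]. The penalised maximum lies on the
    circle, so [|f z|^2 <= |f z| * M + eps] for every [eps > 0], and one factor [|f z|] cancels. *)
Lemma max_modulus (f : C -> C) (r M : R) :
  analytic_on_disc f -> r < 1 ->
  (forall z, Cmod z = r -> Cmod (f z) <= M) ->
  forall z, Cmod z <= r -> Cmod (f z) <= M.
Proof.
intros Hf Hr1 HM z Hz.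
assert (Hr0 : 0 <= r) by (apply Rle_trans with (2 := Hz); apply Cmod_ge_0).
set (l := Cconj (f z)).
assert (Hl : Re (l * f z)%C = Cmod (f z) * Cmod (f z)).
{ rewrite Cmod_sqr. unfold l, Cconj, Cmult, Re, Im; simpl. ring. }
assert (Hlm : Cmod l = Cmod (f z)) by apply Cmod_conj.
assert (Hfz := Cmod_ge_0 (f z)).
assert (Hineq : Cmod (f z) * Cmod (f z) <= Cmod (f z) * M).
{ apply le_epsilon. intros eps Heps.
  destruct (closed_disc_max
    (fun w => Re (l * f w)%C + eps * (Cmod w * Cmod w)) r Hr0) as [p [Hp Hmax]].
  { intros p Hp. apply continuous_penalised; [exact Hf | | exact Heps].
    unfold disc; lra. }
  destruct (Rle_lt_or_eq_dec _ _ Hp) as [Hlt|Heq].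
  { now destruct (penalised_no_interior_max f l p eps r Hf Heps Hr1 Hlt). }
  assert (H1 := Hmax z Hz). rewrite Hl, Heq in H1.
  assert (H2 : Re (l * f p)%C <= Cmod (f z) * M).
  { apply Rle_trans with (1 := Rle_abs _).
    apply Rle_trans with (1 := Re_le_Cmod _).
    rewrite Cmod_mult, Hlm. apply Rmult_le_compat_l; [exact Hfz | now apply HM]. }
  assert (H3 : 0 <= Cmod z * Cmod z) by (apply Rmult_le_pos; apply Cmod_ge_0).
  assert (H4 : r * r <= 1) by nra.
  nra. }
destruct (Rle_lt_or_eq_dec _ _ Hfz) as [Hpos|Hzero].
- apply Rmult_le_reg_l with (1 := Hpos). exact Hineq.
(* When [f z = 0] nothing can be cancelled; [0 <= M] comes from the point [r] of the circle. *)
- rewrite <- Hzero.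
  apply Rle_trans with (2 := HM (RtoC r)
    ltac:(rewrite Cmod_R; now apply Rabs_pos_eq)).
  apply Cmod_ge_0.
Qed.

(** * The norm of [Hinf] *)

Lemma disc_0 : disc 0%C.
Proof. unfold disc. rewrite Cmod_0. lra. Qed.

(** Boundedness excludes [p_infty] and the value at 0 excludes [m_infty], so [real] loses
    nothing. *)
Lemma Hnorm_is_lub (f : Hinf) :
  is_lub_Rbar (fun r : R => exists z : C, disc z /\ r = Cmod (f z))
    (Finite (Hnorm f)).
Proof.
unfold Hnorm.
set (E := fun r : R => exists z : C, disc z /\ r = Cmod (f z)).
assert (H := Lub_Rbar_correct E).
destruct (Hfun_bounded f) as [M HM].
assert (H1 := proj2 H (Finite M)
  ltac:(intros x [z [Hz ->]]; exact (HM z Hz))).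
assert (H2 := proj1 H (Cmod (f 0%C))
  ltac:(exists 0%C; exact (conj disc_0 eq_refl))).
destruct (Lub_Rbar E) as [s| |]; [exact H | contradiction | contradiction].
Qed.

Lemma Hnorm_ge (f : Hinf) (z : C) : disc z -> Cmod (f z) <= Hnorm f.
Proof.
intros Hz. apply (proj1 (Hnorm_is_lub f)). now exists z.
Qed.

Lemma Hnorm_le (f : Hinf) (M : R) :
  (forall z, disc z -> Cmod (f z) <= M) -> Hnorm f <= M.
Proof.
intros H. apply (proj2 (Hnorm_is_lub f) (Finite M)).
intros x [z [Hz ->]]. exact (H z Hz).
Qed.

(** * Upper bound for the backward shift *)

Lemma backward_shift_norm_le (f : Hinf) :
  Hnorm (backward_shift f) <= 2 * Hnorm f.
Proof.
set (N := Hnorm f).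
apply Hnorm_le. intros z Hz. change (disc z) in Hz. unfold disc in Hz.
assert (HN : 0 <= N)
  by (apply Rle_trans with (2 := Hnorm_ge f 0%C disc_0); apply Cmod_ge_0).
set (g := backward_shift f).
assert (Hr : forall r, 0 < r < 1 -> Cmod z <= r -> Cmod (g z) <= 2 * N / r).
{ intros r [Hr0 Hr1] Hzr.
  apply (max_modulus g r);
    [apply Hfun_analytic | exact Hr1 | | exact Hzr].
  intros w Hw.
  assert (Hw0 : w <> 0%C) by (apply Cmod_gt_0; lra).
  unfold g, backward_shift, backward_shift_fun; simpl.
  destruct (Ceq_dec w 0) as [|_]; [contradiction|].
  rewrite Cmod_div, Hw by exact Hw0.
  apply Rmult_le_compat_r; [left; now apply Rinv_0_lt_compat|].
  assert (H1 := Hnorm_ge f w ltac:(unfold disc; lra)).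
  assert (H2 := Hnorm_ge f 0%C disc_0).
  assert (H3 := Cmod_triangle (f w) (- f 0%C)%C). rewrite Cmod_opp in H3.
  fold (f w - f 0%C)%C in H3. fold N in H1, H2. lra. }
assert (Hg := Cmod_ge_0 (g z)). assert (Hz0 := Cmod_ge_0 z).
(* The limit [r -> 1] is replaced by a contradiction: if [|g z| > 2 * N] then [q < 1], and a radius
   [r] above both [q] and [|z|] gives [r * |g z| <= 2 * N = q * |g z|]. *)
apply Rnot_lt_le. intros Hlt.
set (q := 2 * N / Cmod (g z)).
assert (Hq : 0 <= q < 1).
{ unfold q. split.
  - apply Rdiv_le_0_compat; lra.
  - apply Rmult_lt_reg_r with (Cmod (g z)); [lra|].
    unfold Rdiv. rewrite Rmult_assoc, Rinv_l by lra. lra. }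
assert (Hqg : q * Cmod (g z) = 2 * N) by (unfold q; field; lra).
set (r := (Rmax q (Cmod z) + 1) / 2).
assert (H1 := Rmax_l q (Cmod z)). assert (H2 := Rmax_r q (Cmod z)).
assert (H3 : Rmax q (Cmod z) < 1) by (apply Rmax_lub_lt; lra).
assert (H4 := Hr r ltac:(unfold r; lra) ltac:(unfold r; lra)).
assert (Hr0 : 0 < r) by (unfold r; lra).
assert (H5 : Cmod (g z) * r <= 2 * N).
{ apply Rmult_le_compat_r with (r := r) in H4; [|lra].
  unfold Rdiv in H4. rewrite (Rmult_assoc (2 * N)), Rinv_l in H4 by lra. lra. }
assert (q < r) by (unfold r; lra).
nra.
Qed.

(** * Disc automorphisms *)

Lemma is_pseries_const (c h : C) :
  @is_pseries C_AbsRing C_NormedModule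
    (fun n => match n with O => c | S _ => RtoC 0 end) h c.
Proof.
apply (filterlim_ext (fun _ : nat => c)); [|apply filterlim_const].
intros n. symmetry. induction n as [|n IH].
- rewrite sum_O. exact (Cmult_1_l c).
- rewrite sum_Sn, IH.
  change (c + pow_n h (S n) * 0 = c)%C. ring.
Qed.

Lemma analytic_affine (f : C -> C) (c d : C) :
  analytic_on_disc f -> analytic_on_disc (fun z => c + d * f z)%C.
Proof.
intros Hf z0 Hz0. destruct (Hf z0 Hz0) as [a [r [Hr Ha]]].
eexists _, r. split; [exact Hr|]. intros z Hz.
apply (@is_pseries_plus C_AbsRing C_NormedModule).
- apply is_pseries_const.
- apply (@is_pseries_scal C_AbsRing C_NormedModule d a (z - z0)%C (f z)).
  + exact (Cmult_comm _ _).
  + exact (Ha z Hz).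
Qed.

(** Writing [z - p = q + (z - z0)], the expansion is that of the constant 1 divided by [q + h], so
    [quotient_coef] applies with [q] as base point and [c = 0]. *)
Lemma analytic_inv (p : C) :
  1 <= Cmod p -> analytic_on_disc (fun z => / (z - p))%C.
Proof.
intros Hp z0 Hz0. unfold disc in Hz0.
set (q := (z0 - p)%C).
assert (Hq : 0 < Cmod q).
{ assert (H := Cmod_triangle z0 (- q)%C). rewrite Cmod_opp in H.
  replace (z0 + - q)%C with p in H by (unfold q; ring). lra. }
assert (Hq0 : q <> 0%C) by now apply Cmod_gt_0.
set (one := fun n : nat => match n with O => RtoC 1 | S _ => RtoC 0 end).
assert (H1 : forall n, Cmod (one n) * (Cmod q / 2) ^ n <= 1).
{ intros [|n]; simpl; [rewrite Cmod_1 | rewrite Cmod_0]; lra. }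
assert (Hb := quotient_coef_bound q 0%C one (Cmod q / 2) 1
  ltac:(lra) ltac:(lra) H1).
exists (quotient_coef q 0%C one), (Cmod q / 2).
split; [lra|]. intros z Hzr.
destruct (psC_ex _ (Cmod q / 2) _ (z - z0)%C ltac:(lra) Hb Hzr) as [S HS].
assert (E := quotient_coef_pseries q 0%C one _ _ S Hq0
  (is_pseries_const (RtoC 1) (z - z0)%C) HS).
replace (q + (z - z0))%C with (z - p)%C in E by (unfold q; ring).
assert (Hzp : (z - p <> 0)%C).
(* [E] says [(z - p) * S = 1 - 0], which fails if [z = p]. *)
{ intros H0. rewrite H0 in E. apply (f_equal Re) in E. simpl in E. lra. }
replace (/ (z - p))%C with S; [exact HS|].
replace S with ((z - p) * S / (z - p))%C by (field; exact Hzp).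
rewrite E. field. exact Hzp.
Qed.

(** On the disc this is [(z - a) / (1 - a z)]; the partial fraction form makes
    its analyticity immediate. *)
Definition mobius (a : R) (z : C) : C :=
  (- RtoC (/ a) + RtoC ((a - / a) / a) * / (z - RtoC (/ a)))%C.

Lemma one_minus_neq_0 (a : R) (z : C) :
  0 < a < 1 -> disc z -> (1 - a * z)%C <> 0%C.
Proof.
unfold disc. intros Ha Hz H.
assert (E : (RtoC a * z = 1)%C)
  by (replace (a * z)%C with (1 - (1 - a * z))%C by ring; rewrite H; ring).
apply (f_equal Cmod) in E.
rewrite Cmod_mult, Cmod_R, Rabs_pos_eq, Cmod_1 in E by lra.
assert (H0 := Cmod_ge_0 z). nra.
Qed.

Lemma mobius_eq (a : R) (z : C) :
  0 < a < 1 -> disc z -> mobius a z = ((z - a) / (1 - a * z))%C.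
Proof.
intros Ha Hz. assert (H := one_minus_neq_0 a z Ha Hz).
assert (Ha0 : RtoC a <> 0%C) by (intros E; apply RtoC_inj in E; lra).
unfold mobius.
rewrite RtoC_div, RtoC_minus, !RtoC_inv by lra.
field. repeat split; try assumption.
intros E. apply H. replace (1 - a * z)%C with (- (z * a - 1))%C by ring.
rewrite E. ring.
Qed.

Lemma mobius_le_1 (a : R) (z : C) :
  0 < a < 1 -> disc z -> Cmod (mobius a z) <= 1.
Proof.
intros Ha Hz. assert (H := one_minus_neq_0 a z Ha Hz).
assert (Hd : 0 < Cmod (1 - a * z)%C) by now apply Cmod_gt_0.
rewrite mobius_eq, Cmod_div by assumption.
apply Rmult_le_reg_r with (1 := Hd).
unfold Rdiv. rewrite Rmult_assoc, Rinv_l, Rmult_1_l, Rmult_1_r by lra.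
apply Rsqr_incr_0_var; [|lra]. unfold Rsqr.
assert (Hz2 : Cmod z * Cmod z <= 1)
  by (unfold disc in Hz; assert (H0 := Cmod_ge_0 z); nra).
rewrite Cmod_sqr in *. rewrite Cmod_sqr.
destruct z as [x y]. unfold Re, Im, RtoC, Cminus, Cplus, Copp, Cmult in *.
simpl in *.
(* This product equals [|1 - a z|^2 - |z - a|^2]. *)
assert (0 <= (1 - a * a) * (1 - (x * x + y * y)))
  by (apply Rmult_le_pos; nra).
nra.
Qed.

(** The only pole, [1 / a], lies outside the disc. *)
Lemma mobius_analytic (a : R) : 0 < a < 1 -> analytic_on_disc (mobius a).
Proof.
intros Ha. apply (analytic_affine (fun z => / (z - RtoC (/ a)))%C).
apply analytic_inv.
assert (1 < / a) by (rewrite <- Rinv_1; apply Rinv_lt_contravar; lra).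
rewrite Cmod_R, Rabs_pos_eq; lra.
Qed.

Lemma mobius_bounded (a : R) : 0 < a < 1 -> bounded_on_disc (mobius a).
Proof. intros Ha. exists 1. intros z Hz. now apply mobius_le_1. Qed.

Definition mobius_Hinf (a : R) (Ha : 0 < a < 1) : Hinf :=
  mkHinf (mobius a) (mobius_analytic a Ha) (mobius_bounded a Ha).

(** As [mobius a 0 = - a], the difference [(x - a) / (1 - a x) + a] has numerator [x (1 - a^2)].
    Positive real points suffice for the lower bound. *)
Lemma backward_shift_mobius (a x : R) :
  0 < a < 1 -> 0 < x < 1 ->
  backward_shift_fun (mobius a) x = RtoC ((1 - a * a) / (1 - a * x)).
Proof.
intros Ha Hx. unfold backward_shift_fun.
assert (Hx0 : RtoC x <> 0%C) by (intros E; apply RtoC_inj in E; lra).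
destruct (Ceq_dec x 0) as [|_]; [contradiction|].
assert (Hd : disc x) by (unfold disc; rewrite Cmod_R, Rabs_pos_eq; lra).
assert (H := one_minus_neq_0 a x Ha Hd).
assert (0 < 1 - a * x) by nra.
rewrite !mobius_eq by (assumption || apply disc_0).
rewrite RtoC_div, !RtoC_minus, !RtoC_mult by lra.
field. repeat split; try assumption.
Qed.

Theorem theorem2p5 : operator_norm backward_shift = Finite 2.
Proof.
apply is_lub_Rbar_unique. split.
- intros s [f [Hf ->]]. change (Hnorm (backward_shift f) <= 2).
  assert (H := backward_shift_norm_le f). lra.
- intros b Hb.
  (* Take [a = 1 - e] and [x = 1 - e^2], so that [x] tends to 1 faster than [a]. The value is then
     [(2 - e) / (1 + e - e^2)], which is at least [2 - 3 e]. *)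
  assert (He : forall e, 0 < e < 1 -> Rbar_le (2 - 3 * e) b).
  { intros e He.
    assert (Ha : 0 < 1 - e < 1) by lra.
    assert (Hx : 0 < 1 - e * e < 1) by nra.
    apply Rbar_le_trans with
      (Finite (Hnorm (backward_shift (mobius_Hinf (1 - e) Ha)))).
    + assert (Hd : disc (RtoC (1 - e * e)))
        by (unfold disc; rewrite Cmod_R, Rabs_pos_eq; lra).
      assert (H := Hnorm_ge (backward_shift (mobius_Hinf (1 - e) Ha)) _ Hd).
      simpl in H. rewrite backward_shift_mobius, Cmod_R in H by assumption.
      refine (Rle_trans _ _ _ _ H).
      apply Rle_trans with (2 := Rle_abs _).
      assert (Hden : 0 < 1 - (1 - e) * (1 - e * e)) by nra.
      apply Rmult_le_reg_r with (1 := Hden).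
      unfold Rdiv. rewrite (Rmult_assoc (1 - _)), Rinv_l by lra.
      nra.
    + apply Hb. eexists. split; [|reflexivity].
      apply Hnorm_le. intros z Hz. now apply mobius_le_1. }
  destruct b as [b| |].
  + simpl in *. apply le_epsilon. intros e Hepos.
    assert (H1 := Rmin_l (e / 3) (1 / 2)).
    assert (H2 := He (Rmin (e / 3) (1 / 2))
      ltac:(split; [apply Rmin_pos | apply Rle_lt_trans with (1 := Rmin_r _ _)];
            lra)).
    lra.
  + exact I.
  (* For [b = m_infty], a finite lower bound is already absurd. *)
  + exact (He (1 / 2) ltac:(lra)).
Qed.
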